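(* Let $K$ be a field, $S=K[x_1,\ldots,x_n]$, and let $I\subset S$ be a nonzero proper monomial ideal with $\operatorname{Ass}(S/I)=\{P_1,\ldots,P_s\}$ (the $P_i$ pairwise distinct) such that $P_i\not\subset \sum_{1\le j\le s,\, j\neq i}P_j$ for all $i\in\{1,\ldots,s\}$. Then $I$ has minimal depth, i.e. $\operatorname{depth}(I)=\operatorname{size}(I)+1$.
   Context: Depth is taken with respect to the graded maximal ideal $\mathfrak m=(x_1,\ldots,x_n)$ of $S$, with ideals regarded as $S$-modules. An empty sum of ideals is the zero ideal. Size: let $I=\bigcap_{i=1}^s Q_i$ be an irredundant primary decomposition of the nonzero proper monomial ideal $I$, where the $Q_i$ are monomial ideals and $Q_i$ is $P_i$-primary, with the $P_i$ pairwise distinct, so $\operatorname{Ass}(S/I)=\{P_1,\ldots,P_s\}$. Then $\operatorname{size}(I)=a+(n-b)-1$, where $a$ is the minimum number $t$ such that there exist $j_1<\cdots<j_t$ with $\sqrt{\sum_{l=1}^t Q_{j_l}}=\sqrt{\sum_{j=1}^s Q_j}$, and $b=\operatorname{height}(\sum_{j=1}^s Q_j)$. This depends only on $\operatorname{Ass}(S/I)$. The ideal $I$ is said to have minimal depth if $\operatorname{depth}(I)=\operatorname{size}(I)+1$. *)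

(* Defs.v *)
From mathcomp Require Import all_boot all_order all_algebra.
From mathcomp Require Import classical_sets.
From mathcomp Require Import mpoly.

Set Implicit Arguments.
Unset Strict Implicit.
Unset Printing Implicit Defensive.

Import GRing.Theory.
Local Open Scope ring_scope.
Local Open Scope classical_set_scope.

Section Ideals.
Variable R : comNzRingType.
Implicit Types A I P Q : set R.

Definition is_ideal I : Prop :=
  [/\ I 0, forall f g, I f -> I g -> I (f + g)
         & forall a f, I f -> I (a * f)].

Definition idealgen A : set R := smallest is_ideal A.

(* For an empty index set J this is the zero ideal. *)
Definition ideal_sum (T : finType) (J : {pred T}) (Q : T -> set R) : set R :=
  [set f | exists2 g : T -> R,
     (forall i, i \in J -> Q i (g i)) & f = \sum_(i in J) g i].

Definition ideal_cap (T : finType) (J : {pred T}) (Q : T -> set R) : set R :=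
  [set f | forall i, i \in J -> Q i f].

Definition radical I : set R := [set f | exists k : nat, I (f ^+ k)].

Definition is_prime P : Prop :=
  [/\ is_ideal P, ~ P 1 & forall f g, P (f * g) -> P f \/ P g].

Definition is_primary Q P : Prop :=
  [/\ is_ideal Q, ~ Q 1, forall f g, Q (f * g) -> Q f \/ radical Q g
    & radical Q = P].

(* Ass(R/I): the primes that are annihilators of an element f + I of R/I. *)
Definition Ass I : set (set R) :=
  [set P | is_prime P /\ exists f, P = [set g | I (g * f)]].

(* h is the supremum of the lengths of strict chains P_0 < ... < P_k = P of
   prime ideals. *)
Definition prime_chain P (k : nat) (c : nat -> set R) : Prop :=
  [/\ forall i, (i <= k)%N -> is_prime (c i),
      forall i, (i < k)%N -> c i `<` c i.+1
    & c k = P].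

Definition is_prime_height P (h : nat) : Prop :=
  (exists c, prime_chain P h c)
  /\ (forall k c, prime_chain P k c -> (k <= h)%N).

(* The minimum of the heights of the primes containing I. Primes of infinite
   height have no is_prime_height and so do not constrain the minimum. *)
Definition is_height I (h : nat) : Prop :=
  (exists P, [/\ is_prime P, I `<=` P & is_prime_height P h])
  /\ (forall P k, is_prime P -> I `<=` P -> is_prime_height P k -> (h <= k)%N).

(* The submodule (f_1, ..., f_r) M of an ideal M, regarded as an R-module. *)
Definition seq_mul (fs : seq R) (M : set R) : set R :=
  idealgen [set f * g | f in [set` fs] & g in M].

(* fs is an M-regular sequence, for an ideal M regarded as an R-module: each
   f_i is a nonzerodivisor on M/(f_1, ..., f_{i-1})M, and M/(f_1, ..., f_r)M
   is nonzero. *)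
Definition regular_seq (M : set R) (fs : seq R) : Prop :=
  (forall i g, (i < size fs)%N -> M g ->
     seq_mul (take i fs) M (fs`_i * g) -> seq_mul (take i fs) M g)
  /\ seq_mul fs M <> M.

(* The depth of the R-module M with respect to the ideal m: the maximal length
   of an M-regular sequence contained in m. *)
Definition is_depth (m M : set R) (d : nat) : Prop :=
  (exists fs : seq R, [/\ [set` fs] `<=` m, regular_seq M fs & size fs = d])
  /\ (forall fs : seq R,
        [set` fs] `<=` m -> regular_seq M fs -> (size fs <= d)%N).

End Ideals.

Section MonomialIdeals.
Variables (K : fieldType) (n : nat).
Local Notation S := {mpoly K[n]}.

Definition graded_maximal : set S := idealgen (range (fun i : 'I_n => 'X_i)).

Definition is_monomial_ideal (I : set S) : Prop :=
  exists G : set 'X_{1..n}, I = idealgen [set 'X_[m] | m in G].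

Definition irredundant_primary_decomposition (I : set S) (s : nat)
    (Q P : 'I_s -> set S) : Prop :=
  [/\ forall i, is_monomial_ideal (Q i) /\ is_primary (Q i) (P i),
      injective P,
      I = ideal_cap predT Q
    & forall i, I <> ideal_cap (predC1 i) Q].

(* Index sequences j_1 < ... < j_t are encoded as sets J of cardinality t. *)
Definition spans_radical (s : nat) (Q : 'I_s -> set S) (t : nat) : Prop :=
  exists J : {set 'I_s},
    #|J| = t /\ radical (ideal_sum (mem J) Q) = radical (ideal_sum predT Q).

(* z = a + (n - b) - 1; the arithmetic is in int to avoid truncation. *)
Definition size_of_decomposition (s : nat) (Q : 'I_s -> set S) (z : int) :
    Prop :=
  exists a b : nat,
    [/\ spans_radical Q a, forall t, spans_radical Q t -> (a <= t)%N,
        is_height (ideal_sum predT Q) b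
      & z = a%:Z + (n%:Z - b%:Z) - 1].

(* The size of I does not depend on the decomposition: one exists, and all of
   them give the value z. *)
Definition is_size (I : set S) (z : int) : Prop :=
  (exists s (Q P : 'I_s -> set S), irredundant_primary_decomposition I Q P)
  /\ (forall s (Q P : 'I_s -> set S),
        irredundant_primary_decomposition I Q P -> size_of_decomposition Q z).

Definition has_minimal_depth (I : set S) : Prop :=
  exists (d : nat) (z : int),
    [/\ is_depth graded_maximal I d, is_size I z & d%:Z = z + 1].

End MonomialIdeals.

(* Main.v *)
Require Import Defs.
From mathcomp Require Import all_boot all_order all_algebra.
From mathcomp Require Import boolp classical_sets.
From mathcomp Require Import mpoly.
From mathcomp Require Import ring zify.

Set Implicit Arguments.
Unset Strict Implicit.
Unset Printing Implicit Defensive.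

Import Order.TTheory GRing.Theory.
Local Open Scope ring_scope.
Local Open Scope classical_set_scope.

(** Let [A i] be the set of variables of the prime [P i], for a monomial prime
    is generated by variables, and let [B] be the union of the [A i]. The
    hypothesis says that each [P i] contains a private variable [k i], lying in
    no other [P j]. Both the size plus one and the depth are then
    [s + (n - |B|)].

    For the size: the private variables prevent a proper subfamily of the
    components from having the same radical sum as all of them, and the prime
    generated by [B] has height [|B|]. The height rests on the bound [n] for the
    length of a chain of primes. Choosing an element in each step of a longer
    chain would give [n + 1] elements, which satisfy a nontrivial polynomial
    relation by a count of monomials, and the primes of the chain successively
    strip that relation down to the coefficient of its lexicographically least
    term, which would have to vanish ([chain_relation], [krull_dim_le]).

    For the lower bound on the depth: the private variables together with the
    variables outside [B] form a regular sequence on [I]. Any two of them, [x]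
    and [y], have the property that the ideals (I : x) and (I : y) intersect in
    [I], since no component contains powers of both; for a sequence of
    variables and a monomial ideal this pairwise condition is enough
    ([variables_regular]).

    For the upper bound: if [I] has a regular sequence of length [p], the Koszul
    complex of [x_1 ^ N, ..., x_n ^ N] with values in [I] is acyclic in degrees
    below [p], for every [N] ([regular_seq_koszul_acyclic]). On the other hand,
    distribute the variables of [B] among the [A i], with [k i] going to [A i],
    and let [w i] be the sum of the [x_l ^ N e_l] over the [l] attributed to
    [A i]. The differential is the exterior product with the sum of the [w i]
    and of the [x_l ^ N e_l] for [l] outside [B], so it kills the exterior
    product of the [w i] and of these [e_l]. For large [N] this cocycle has
    values in every component, hence in [I], and its coefficient at the
    sequence of private and outer variables is the monomial
    [x_(k 1) ^ N ... x_(k s) ^ N]. No coboundary contains that monomial there,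
    because deleting the factor [x_(k i) ^ N] leaves a monomial outside [P i].
    This is a nonzero class in degree [s + (n - |B|)]
    ([private_koszul_nonacyclic]).

    The size being a statement about all decompositions, the components of each
    of them have to be matched with the given primes ([Ass_decomposition]), and
    one has to exist ([monomial_decomposition_exists]). *)

(** * Ideals of a commutative ring *)

Section Ideals.
Variable R : comNzRingType.
Implicit Types (A J M P Q : set R) (f g h : R).

Lemma ideal0 J : is_ideal J -> J 0. Proof. by case. Qed.

Lemma ideal_add J f g : is_ideal J -> J f -> J g -> J (f + g).
Proof. by case=> _ + _; apply. Qed.

Lemma ideal_mulr J f g : is_ideal J -> J g -> J (f * g).
Proof. by case=> _ _; apply. Qed.

Lemma ideal_mull J f g : is_ideal J -> J f -> J (f * g).
Proof. by move=> Jid Jf; rewrite mulrC; apply: ideal_mulr. Qed.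

Lemma idealN J f : is_ideal J -> J f -> J (- f).
Proof. by move=> Jid Jf; rewrite -mulN1r; apply: ideal_mulr. Qed.

Lemma idealB J f g : is_ideal J -> J f -> J g -> J (f - g).
Proof. by move=> Jid Jf Jg; apply: ideal_add => //; apply: idealN. Qed.

Lemma ideal_bigsum J (T : Type) (r : seq T) (p : pred T) (F : T -> R) :
  is_ideal J -> (forall i, p i -> J (F i)) -> J (\sum_(i <- r | p i) F i).
Proof.
move=> Jid JF; elim/big_ind: _ => [|f g|] //; first exact: ideal0.
exact: ideal_add.
Qed.

Lemma idealgen_ideal A : is_ideal (idealgen A).
Proof.
split=> [J [[J0 _ _]] //|f g fA gA J JA|a f fA J JA].
  by case: (JA) => -[_ JD _] _; apply: JD; [apply: fA|apply: gA].
by case: (JA) => -[_ _ JM] _; apply: JM; apply: fA.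
Qed.

Lemma idealgen_sub A J : is_ideal J -> A `<=` J -> idealgen A `<=` J.
Proof. exact: smallest_sub. Qed.

Lemma zero_ideal : is_ideal [set (0 : R)].
Proof. by split=> [//|_ _ -> ->|b _ ->]; rewrite ?addr0 ?mulr0. Qed.

Lemma radical_sub J : J `<=` radical J.
Proof. by move=> f Jf; exists 1; rewrite /= expr1. Qed.

Lemma radicalS J J' : J `<=` J' -> radical J `<=` radical J'.
Proof. by move=> JJ' f [k /JJ']; exists k. Qed.

Lemma radical_ideal J : is_ideal J -> is_ideal (radical J).
Proof.
move=> Jid; split=> [|f g [k Jfk] [l Jgl]|a f [k Jfk]].
- by apply: radical_sub; apply: ideal0.
- exists (k + l)%N; rewrite /= exprDn; apply: ideal_bigsum => // i _.
  rewrite -mulr_natr; apply: ideal_mull => //.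
  have [il|li] := leqP i l.
    by rewrite -addnBA // exprD -mulrA; apply: ideal_mull.
  by rewrite -(subnK (ltnW li)) exprD mulrA; apply: ideal_mulr.
- by exists k; rewrite /= exprMn; apply: ideal_mulr.
Qed.

Lemma prime_ideal P : is_prime P -> is_ideal P. Proof. by case. Qed.

Lemma prime_X P f k : is_prime P -> P (f ^+ k) -> P f.
Proof.
case=> Pid P1 PM; elim: k => [|k IHk]; first by rewrite expr0.
by rewrite exprS => /PM[].
Qed.

Lemma prime_prod P (T : Type) (r : seq T) (F : T -> R) : is_prime P ->
  P (\prod_(i <- r) F i) -> exists i, P (F i).
Proof.
case=> Pid P1 PM; elim: r => [|i r IHr]; first by rewrite big_nil.
by rewrite big_cons => /PM[|/IHr//]; exists i.
Qed.

Lemma prime_radical P : is_prime P -> radical P `<=` P.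
Proof. by move=> Pp f [k]; apply: prime_X. Qed.

Section Sums.
Variables (T : finType) (Q : T -> set R).

Lemma ideal_sum_ideal (J : {pred T}) :
  (forall i, is_ideal (Q i)) -> is_ideal (ideal_sum J Q).
Proof.
move=> Qid; split=> [|f g [u uQ ->] [v vQ ->]|a f [u uQ ->]].
- by exists (fun=> 0); [move=> i _; apply: ideal0|rewrite big1].
- exists (fun i => u i + v i); last by rewrite big_split.
  by move=> i iJ; apply: ideal_add => //; [apply: uQ|apply: vQ].
- exists (fun i => a * u i); last by rewrite big_distrr.
  by move=> i iJ; apply: ideal_mulr => //; apply: uQ.
Qed.

Lemma ideal_sum_ge (J : {pred T}) i :
  (forall i, is_ideal (Q i)) -> i \in J -> Q i `<=` ideal_sum J Q.
Proof.
move=> Qid iJ f Qf; exists (fun j => if j == i then f else 0).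
  by move=> j _; case: eqP => [->//|_]; apply: ideal0.
by rewrite (bigD1 i) //= eqxx big1 ?addr0 // => j /andP[_ /negbTE ->].
Qed.

Lemma ideal_sum_le (J : {pred T}) M :
  is_ideal M -> (forall i, i \in J -> Q i `<=` M) -> ideal_sum J Q `<=` M.
Proof. by move=> Mid QM _ [u uQ ->]; apply: ideal_bigsum => // i iJ; exact/QM/uQ. Qed.

End Sums.

Lemma prime_chain_extend P P' k c : is_prime P' -> P `<` P' ->
  prime_chain P k c ->
  prime_chain P' k.+1 (fun i => if (i <= k)%N then c i else P').
Proof.
move=> P'prime PP' [cprime clt ck]; split=> [i _|i|]; last by rewrite ltnn.
  by case: leqP => // ik; apply: cprime.
rewrite ltnS => ik; rewrite ik; case: ltnP => [|ki]; first exact: clt.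
by have -> : i = k by [apply/eqP; rewrite eqn_leq ik]; rewrite ck.
Qed.

(** * Primary decompositions and associated primes *)

Section Primary.
Variables (Q P : set R) (Qprimary : is_primary Q P).

Lemma primary_ideal : is_ideal Q. Proof. by case: Qprimary. Qed.

Lemma primary_sub : Q `<=` P.
Proof. by case: Qprimary => _ _ _ <-; apply: radical_sub. Qed.

Lemma primary_cancel f g : Q (f * g) -> ~ P g -> Q f.
Proof. by case: Qprimary => _ _ QM <- /QM[]. Qed.

End Primary.

(** A prime annihilator of [f] contains the product of the ideals [(Q i : f)]
    over the [Q i] not containing [f], hence one of them. It is contained in
    each of them, so it equals that one, and its radical is [P i]. *)
Lemma Ass_sub_decomposition (s : nat) (Q P : 'I_s -> set R) :
  (forall i, is_primary (Q i) (P i)) -> Ass (ideal_cap predT Q) `<=` range P.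
Proof.
move=> Qprim X [Xprime [f Xf]].
have XM h : X h <-> forall i, Q i (h * f).
  by rewrite Xf; split=> [Qh i|Qh i _]; apply: Qh.
have [i [Qf colonX]] : exists i, ~ Q i f /\ forall h, Q i (h * f) -> X h.
  apply: contrapT => noi.
  have /choice[h hP] i : exists h, Q i (h * f) /\ ~ X h.
    have [Qf|nQf] := pselect (Q i f).
      by exists 1; rewrite mul1r; split=> //; case: Xprime.
    apply: contrapT => noh; apply: noi; exists i; split=> // h Qh.
    by apply: contrapT => nXh; apply: noh; exists h.
  have /(prime_prod Xprime)[i] : X (\prod_(i <- enum 'I_s) h i).
    apply/XM => i; have Qid := primary_ideal (Qprim i).
    rewrite (big_rem i) ?mem_enum //= mulrC mulrA.
    by apply: ideal_mull => //; rewrite mulrC; have [] := hP i.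
  by have [] := hP i.
have [_ _ QM QP] := Qprim i; have Qid := primary_ideal (Qprim i).
exists i => //; apply/seteqP; split=> h.
  rewrite -QP => -[k Qhk]; apply: (prime_X (k := k) Xprime).
  by apply: colonX; apply: ideal_mull.
by move=> /XM/(_ i); rewrite mulrC => /QM[]// ; rewrite QP.
Qed.

End Ideals.

(** * Koszul cocycles *)

Section Koszul.
Variables (R : comNzRingType) (n : nat).
Implicit Types (w v : 'I_n -> R) (c e : seq 'I_n -> R) (t : seq 'I_n).
Implicit Types (M N : set R).

(** Cochains are arbitrary families indexed by sequences of indices, not
    alternating ones: [c] restricted to sequences of size [p] is a cochain of
    degree [p]. This form of the Koszul complex of [w] turns every identity
    below into a one-step recursion. *)
Fixpoint kd w c t : R :=
  if t is i :: t' then w i * c t' - kd w (fun u => c (i :: u)) t' else 0.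

Lemma eq_kd w c c' t : c =1 c' -> kd w c t = kd w c' t.
Proof.
elim: t c c' => //= i t IHt c c' cc'; rewrite cc'; congr (_ - _).
by apply: IHt => u; apply: cc'.
Qed.

Lemma kdZD w a c c' t :
  kd w (fun u => a * c u + c' u) t = a * kd w c t + kd w c' t.
Proof.
elim: t c c' => /= [|i t IHt] c c'; first by rewrite mulr0 addr0.
by rewrite IHt; ring.
Qed.

Lemma kd0 w t : kd w (fun=> 0) t = 0.
Proof. by elim: t => //= i t ->; rewrite mulr0 subr0. Qed.

Lemma kdZ w a c t : kd w (fun u => a * c u) t = a * kd w c t.
Proof.
rewrite -[RHS]addr0 -(kd0 w t) -kdZD.
by apply: eq_kd => u; rewrite addr0.
Qed.

Lemma kdB w c c' t : kd w (fun u => c u - c' u) t = kd w c t - kd w c' t.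
Proof.
rewrite -[X in _ - X]mul1r -mulNr addrC -kdZD.
by apply: eq_kd => u; rewrite mulN1r addrC.
Qed.

Lemma kd_sum w (T : Type) (r : seq T) (a : T -> R) (F : T -> seq 'I_n -> R) t :
  kd w (fun u => \sum_(x <- r) a x * F x u) t = \sum_(x <- r) a x * kd w (F x) t.
Proof.
elim: r => [|x r IHr].
  by rewrite big_nil -[RHS](kd0 w t); apply: eq_kd => u; rewrite big_nil.
by rewrite big_cons -IHr -kdZD; apply: eq_kd => u; rewrite big_cons.
Qed.

Lemma kd_suml (T : Type) (r : seq T) (a : T -> R) (W : T -> 'I_n -> R) w c t :
  (forall i, w i = \sum_(x <- r) a x * W x i) ->
  kd w c t = \sum_(x <- r) a x * kd (W x) c t.
Proof.
move=> wW; elim: t c => /= [|i t IHt] c.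
  by rewrite big1 // => x _; rewrite mulr0.
rewrite IHt wW big_distrl -sumrB /=.
by apply: eq_bigr => x _; rewrite mulrBr mulrA.
Qed.

Lemma kd_anticomm w v c t : kd w (kd v c) t = - kd v (kd w c) t.
Proof.
elim: t c => /= [|i t IHt] c; first by rewrite oppr0.
by rewrite !kdB !kdZ IHt; ring.
Qed.

Lemma kd_kd w c t : kd w (kd w c) t = 0.
Proof.
by elim: t c => //= i t IHt c; rewrite kdB kdZ IHt subr0 subrr.
Qed.

(** Contraction against [a] is a homotopy between multiplication by
    [\sum_j a j * w j] and zero. *)
Lemma kd_homotopy w a c t :
  \sum_j a j * kd w c (j :: t) =
  (\sum_j a j * w j) * c t - kd w (fun u => \sum_j a j * c (j :: u)) t.
Proof.
rewrite kd_sum big_distrl -sumrB /=.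
by apply: eq_bigr => j _; rewrite mulrBr mulrA.
Qed.

(** [kd w c t] is an alternating sum of the terms [w l * c t'] where [t'] is
    [t] with one entry [l] deleted. *)
Lemma kd_in_subgroup w c (Z : set R) t : Z 0 ->
  (forall f g, Z f -> Z g -> Z (f - g)) ->
  (forall t1 l t2, t = t1 ++ l :: t2 -> Z (w l * c (t1 ++ t2))) -> Z (kd w c t).
Proof.
move=> Z0 ZB; elim: t c => //= i t IHt c Zc.
apply: (ZB); first exact: (Zc [::] i t).
by apply: IHt => t1 l t2 tE; apply: (Zc (i :: t1) l t2); rewrite tE.
Qed.

Lemma kd_in w c (J : set R) t : is_ideal J ->
  (forall u, size u = (size t).-1 -> J (c u)) -> J (kd w c t).
Proof.
move=> Jid Jc; apply: kd_in_subgroup => [|f g|t1 l t2 tE].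
- exact: ideal0.
- exact: idealB.
- by apply: ideal_mulr => //; apply: Jc; rewrite tE !size_cat /= addnS.
Qed.

Lemma kd_in_coef w c (J : set R) t : is_ideal J ->
  (forall l, l \in t -> J (w l)) -> J (kd w c t).
Proof.
move=> Jid Jw; apply: kd_in_subgroup => [|f g|t1 l t2 tE].
- exact: ideal0.
- exact: idealB.
- by apply: ideal_mull => //; apply: Jw; rewrite tE mem_cat mem_head orbT.
Qed.

(** Vanishing of the Koszul cohomology of [M / N] in degree [q]. The quotient is
    represented by a pair of ideals: cochains take values in [M] and are
    compared modulo [N]. *)
Definition koszul_acyclic w M N (q : nat) : Prop :=
  forall c, (forall t, size t = q -> M (c t)) ->
    (forall t, size t = q.+1 -> N (kd w c t)) ->
  exists2 e, (forall t, (size t).+1 = q -> M (e t))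
    & forall t, size t = q -> N (c t - kd w e t).

(** Let [f] be a nonzerodivisor on [M / N], some power of which lies in the
    ideal generated by [w]. That power kills the cohomology of [M / N], by the
    homotopy; each division by [f] costs one use of acyclicity of
    [M / (N + f M)] one degree below. *)
Lemma koszul_acyclic_regular w a f k M N N' (p : nat) :
  is_ideal M -> is_ideal N -> is_ideal N' -> N `<=` N' ->
  (forall g, M g -> N' (f * g)) ->
  (forall h, N' h -> exists2 g, M g & N (h - f * g)) ->
  (forall g, M g -> N (f * g) -> N g) ->
  f ^+ k = \sum_j a j * w j ->
  (forall q, (q < p)%N -> koszul_acyclic w M N' q) ->
  forall q, (q <= p)%N -> koszul_acyclic w M N q.
Proof.
move=> Mid Nid N'id NN' fN' N'P freg fk acyc q qp c cM dcN.
have descend l e : (forall t, (size t).+1 = q -> M (e t)) ->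
    (forall t, size t = q -> N (f ^+ l * c t - kd w e t)) ->
  exists2 e', (forall t, (size t).+1 = q -> M (e' t))
    & forall t, size t = q -> N (c t - kd w e' t).
  elim: l e => [|l IHl] e eM eN.
    by exists e => // t st; have := eN t st; rewrite expr0 mul1r.
  (* In degree zero there are no coboundaries, and [f] cancels directly. *)
  case: q => [|q] in qp c cM dcN eM eN IHl *.
    apply: (IHl (fun=> 0)) => // t st; rewrite kd0 subr0.
    apply: freg; first by apply: ideal_mulr => //; apply: cM.
    by move: (eN t st); case: t st => //= _; rewrite subr0 mulrA -exprS.
  have deN t : size t = q.+1 -> N' (kd w e t).
    move=> st; rewrite -[kd w e t](subKr (f ^+ l.+1 * c t)).
    apply: idealB => //; last by apply: NN'; apply: eN.
    by rewrite exprS -mulrA; apply: fN'; apply: ideal_mulr => //; apply: cM.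
  have [|e' e'M ee'N] := acyc q qp e _ deN; first by move=> t st; apply: eM; rewrite st.
  have /choice[g gP] t : exists g, size t = q -> M g /\ N (e t - kd w e' t - f * g).
    have [st|nst] := pselect (size t = q); last by exists 0.
    by have [g Mg Ng] := N'P _ (ee'N t st); exists g.
  apply: (IHl g) => [t [st]|t st]; first by have [] := gP t st.
  apply: freg.
    apply: idealB => //; first by apply: ideal_mulr => //; apply: cM.
    by apply: kd_in => // u; rewrite st => /gP[].
  have <- : f ^+ l.+1 * c t - kd w e t
      + kd w (fun u => e u - kd w e' u - f * g u) t
      = f * (f ^+ l * c t - kd w g t).
    by rewrite !kdB kd_kd kdZ exprS; ring.
  apply: ideal_add => //; first exact: eN.
  by apply: kd_in => // u; rewrite st => /gP[].
apply: (descend k (fun u => \sum_j a j * c (j :: u))) => t st.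
  by apply: ideal_bigsum => // j _; apply: ideal_mulr => //; apply: cM.
rewrite fk -kd_homotopy; apply: ideal_bigsum => // j _.
by apply: ideal_mulr => //; apply: dcN; rewrite /= st.
Qed.

Lemma seq_mul_take (fs : seq R) M i h : is_ideal M -> (i < size fs)%N ->
  seq_mul (take i.+1 fs) M h ->
  exists2 g, M g & seq_mul (take i fs) M (h - fs`_i * g).
Proof.
move=> Mid ifs; have Nid := idealgen_ideal [set f * g | f in [set` take i fs] & g in M].
apply: (idealgen_sub (J := [set h | exists2 g, M g & seq_mul (take i fs) M (h - fs`_i * g)])).
  split=> [|h1 h2 [g1 Mg1 Nh1] [g2 Mg2 Nh2]|b h1 [g1 Mg1 Nh1]].
  - by exists 0; [apply: ideal0|rewrite mulr0 subr0; apply: ideal0].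
  - exists (g1 + g2); first exact: ideal_add.
    by rewrite mulrDr opprD addrACA; apply: ideal_add Nh1 Nh2.
  - exists (b * g1); first exact: ideal_mulr.
    by rewrite mulrCA -mulrBr; apply: ideal_mulr Nh1.
move=> _ [f /= + [g Mg <-]]; rewrite (take_nth 0) // mem_rcons inE => /predU1P[->|ff].
  by exists g => //; rewrite subrr; apply: ideal0.
exists 0; first exact: ideal0.
by rewrite mulr0 subr0; apply: sub_gen_smallest; exists f => //; exists g.
Qed.

(** Depth sensitivity of the Koszul complex: going backwards along the regular
    sequence, each of its elements adds one degree of acyclicity. *)
Lemma regular_seq_koszul_acyclic w M (fs : seq R) :
  is_ideal M -> regular_seq M fs ->
  (forall f, f \in fs -> exists k a, f ^+ k = \sum_j a j * w j) ->
  forall q, (q < size fs)%N -> koszul_acyclic w M [set 0] q.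
Proof.
move=> Mid [fsreg _] fsw.
have acyc p : (p <= size fs)%N -> forall q, (q < p)%N ->
    koszul_acyclic w M (seq_mul (take (size fs - p) fs) M) q.
  elim: p => // p IHp pfs q qp.
  have ifs : (size fs - p.+1 < size fs)%N by lia.
  have ip : (size fs - p = (size fs - p.+1).+1)%N by lia.
  have [k [a fka]] := fsw _ (mem_nth 0 ifs).
  move: (IHp (ltnW pfs)); rewrite ip; set i := (_ - _)%N in ifs *.
  have genid l : is_ideal (seq_mul l M) by apply: idealgen_ideal.
  move=> acyc; apply: (koszul_acyclic_regular (N' := seq_mul (take i.+1 fs) M) Mid _ _ _ _ _ _ fka acyc) => //.
  - apply: idealgen_sub => // _ [f /= fi [g Mg <-]].
    apply: sub_gen_smallest; exists f; [|by exists g].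
    by rewrite /= (take_nth 0) // mem_rcons inE fi orbT.
  - move=> g Mg; apply: sub_gen_smallest; exists fs`_i; [|by exists g].
    by rewrite /= (take_nth 0) // mem_rcons mem_head.
  - by move=> h; apply: seq_mul_take.
  - by move=> g Mg fg; apply: fsreg.
move=> q qfs; have := acyc _ (leqnn _) q qfs; rewrite subnn take0.
suff -> : seq_mul [::] M = [set 0] by [].
apply/seteqP; split; last first.
  by move=> _ ->; apply: ideal0; apply: idealgen_ideal.
by apply: idealgen_sub => [|h [f /= fnil]]; [exact: zero_ideal|rewrite in_nil in fnil].
Qed.

(** The exterior product of the one-forms [W v], for [v] in [r]. *)
Definition wedge (W : 'I_n -> 'I_n -> R) (r : seq 'I_n) : seq 'I_n -> R :=
  foldr (fun u => kd (W u)) (fun t => (t == [::])%:R) r.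

(** One-forms anticommute and square to zero. *)
Lemma wedge_cocycle W r (v : 'I_n) t : v \in r -> kd (W v) (wedge W r) t = 0.
Proof.
elim: r t => //= u r IHr t; rewrite in_cons.
have [-> _|_ /= vr] := eqVneq v u; first exact: kd_kd.
rewrite kd_anticomm (@eq_kd _ _ (fun=> 0)) ?kd0 ?oppr0 // => x.
exact: IHr.
Qed.

Lemma wedge_in W r (v : 'I_n) (J : set R) t : is_ideal J -> v \in r ->
  (forall l, J (W v l)) -> size t = size r -> J (wedge W r t).
Proof.
move=> Jid + JW; elim: r t => //= u r IHr t; rewrite in_cons => /predU1P[<- _|vr st].
  exact: kd_in_coef.
by apply: kd_in => // x; rewrite st; apply: IHr.
Qed.

Lemma wedge_diag W r : uniq r ->
  (forall u v : 'I_n, u \in r -> v \in r -> u != v -> W u v = 0) ->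
  wedge W r r = \prod_(u <- r) W u u.
Proof.
elim: r => [|u r IHr] /=; first by rewrite big_nil.
case/andP=> ur ru W0; rewrite big_cons IHr // => [|x y xr yr]; last first.
  by apply: W0; rewrite in_cons ?xr ?yr orbT.
rewrite [X in _ - X](_ : _ = 0) ?subr0 //.
apply: (@kd_in_coef _ _ [set 0]) => [|l lr]; first exact: zero_ideal.
by apply: W0; rewrite ?mem_head ?in_cons ?lr ?orbT //; apply: contraNneq ur => ->.
Qed.

End Koszul.

(** * Monomial ideals *)

Section Monomial.
Variables (K : fieldType) (n : nat).
Local Notation S := {mpoly K[n]}.
Implicit Types (U : set 'X_{1..n}) (J Q P : set S) (A : {set 'I_n}) (f g : S).

Definition up_closed U := forall m m', U m -> U (m + m')%MM.

Definition span_mon U : set S := [set f | forall m, m \in msupp f -> U m].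

Lemma span_mon_sub U J :
  is_ideal J -> (forall m, U m -> J 'X_[m]) -> span_mon U `<=` J.
Proof.
move=> Jid UJ f Uf; rewrite (mpolyE f) big_seq.
apply: ideal_bigsum => // m /Uf Um.
by rewrite -mul_mpolyC; apply: ideal_mulr => //; apply: UJ.
Qed.

Lemma span_monX U m : span_mon U 'X_[m] <-> U m.
Proof.
split=> [|Um m']; first by apply; rewrite msuppX mem_head.
by rewrite msuppX inE => /eqP ->.
Qed.

Lemma span_mon_ideal U : up_closed U -> is_ideal (span_mon U).
Proof.
move=> Uup; split=> [m|f g Uf Ug m /msuppD_le|a f Uf m /msuppM_le].
- by rewrite msupp0.
- by rewrite mem_cat => /orP[/Uf|/Ug].
- move=> /allpairsP[[m1 m2] /= [_ /Uf Um2 ->]].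
  by rewrite addmC; apply: Uup.
Qed.

Lemma span_mon_monomial U : up_closed U -> is_monomial_ideal (span_mon U).
Proof.
move=> Uup; exists U; apply/seteqP; split.
  apply: span_mon_sub; first exact: idealgen_ideal.
  by move=> m Um; apply: sub_gen_smallest; exists m.
apply: idealgen_sub; first exact: span_mon_ideal.
by move=> _ [m Um <-]; apply/span_monX.
Qed.

Lemma monomial_ideal_ideal J : is_monomial_ideal J -> is_ideal J.
Proof. by case=> G ->; apply: idealgen_ideal. Qed.

Lemma mon_up_closed J : is_ideal J -> up_closed [set m | J 'X_[m]].
Proof. by move=> Jid m m' /= Jm; rewrite mpolyXD; apply: ideal_mull. Qed.

Lemma monomial_ideal_msupp J f m :
  is_monomial_ideal J -> J f -> m \in msupp f -> J 'X_[m].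
Proof.
move=> Jmon Jf; have Jid := monomial_ideal_ideal Jmon.
case: Jmon => G JG; move: Jf m; rewrite JG.
apply: (idealgen_sub (J := span_mon [set m | idealgen (mpolyX K @` G) 'X_[m]])).
  by apply: span_mon_ideal; rewrite -JG; apply: mon_up_closed.
by move=> _ [m Gm <-]; apply/span_monX; apply: sub_gen_smallest; exists m.
Qed.

Lemma monomial_ideal_span J :
  is_monomial_ideal J -> J = span_mon [set m | J 'X_[m]].
Proof.
move=> Jmon; apply/seteqP; split=> f; first by move=> Jf m; apply: monomial_ideal_msupp.
by apply: span_mon_sub => //; apply: monomial_ideal_ideal.
Qed.

Lemma mnm_subK (m m' : 'X_{1..n}) : (m <= m')%MM -> (m + (m' - m))%MM = m'.
Proof. by move=> mm'; rewrite addmC submK. Qed.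

(** * Primes generated by variables *)

Definition involves A (m : 'X_{1..n}) := [exists k in A, 0 < m k]%N.

Lemma involvesP A (m : 'X_{1..n}) : reflect (exists2 k, k \in A & (0 < m k)%N) (involves A m).
Proof. exact: exists_inP. Qed.

Definition var_prime A : set S := span_mon (involves A).

Lemma involves_up A : up_closed (involves A).
Proof.
move=> m m' /involvesP[k kA mk]; apply/involvesP; exists k => //.
by rewrite mnmDE addn_gt0 mk.
Qed.

Lemma var_prime_ideal A : is_ideal (var_prime A).
Proof. exact/span_mon_ideal/involves_up. Qed.

Lemma var_primeX A k : var_prime A 'X_k <-> k \in A.
Proof.
split=> [/span_monX/involvesP[j jA]|kA].
  by rewrite mnm1E; case: eqP => // ->.
by apply/span_monX/involvesP; exists k => //; rewrite mnm1E eqxx.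
Qed.

Lemma var_prime_sub A J :
  is_ideal J -> (forall k, k \in A -> J 'X_k) -> var_prime A `<=` J.
Proof.
move=> Jid AJ; apply: span_mon_sub => // m /involvesP[k kA mk].
have -> : m = (U_(k) + (m - U_(k)))%MM.
  rewrite mnm_subK //; apply/mnm_lepP => i; rewrite mnm1E.
  by case: eqP => // <-.
by rewrite mpolyXD; apply: ideal_mull => //; apply: AJ.
Qed.

Lemma var_prime_le A A' : A \subset A' -> var_prime A `<=` var_prime A'.
Proof.
move=> AA'; apply: var_prime_sub; first exact: var_prime_ideal.
by move=> k kA; apply/var_primeX; apply: (fintype.subsetP AA').
Qed.

Lemma var_prime_inj : injective var_prime.
Proof.
move=> A A' AA'; apply/setP => k.
by apply/idP/idP => /var_primeX; [rewrite AA'|rewrite -AA'] => /var_primeX.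
Qed.

(** Setting the variables of [A] to zero; its kernel is [var_prime A]. *)
Definition kill A f : S := f \mPo [tuple (if i \in A then 0 else 'X_i) | i < n].

Lemma killM A : {morph kill A : f g / f * g}.
Proof. by move=> f g; rewrite /kill rmorphM. Qed.

Lemma killX A m : kill A 'X_[m] = if involves A m then 0 else 'X_[m].
Proof.
rewrite /kill comp_mpolyX; case: involvesP => [[k kA mk]|noA].
  by rewrite (bigD1 k) //= tnth_mktuple kA expr0n -(prednK mk) mul0r.
rewrite mpolyXE_id; apply: eq_bigr => i _; rewrite tnth_mktuple.
case: ifPn => // iA; have [->|mi] := posnP (m i); first by rewrite !expr0.
by case: noA; exists i.
Qed.

Lemma mcoeff_kill A f m : (kill A f)@_m = if involves A m then 0 else f@_m.
Proof.
rewrite /kill comp_mpolyEX raddf_sum /=.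
transitivity (\sum_(m' <- msupp f) f@_m' * (kill A 'X_[m'])@_m).
  by apply: eq_bigr => m' _; rewrite mcoeffZ.
case: ifPn => mA.
  rewrite big1 // => m' _; rewrite killX; case: ifPn => m'A.
    by rewrite mcoeff0 mulr0.
  by rewrite mcoeffX; case: eqP mA m'A => [->->|]; rewrite ?mulr0.
rewrite [in RHS](mpolyE f) raddf_sum /=; apply: eq_bigr => m' _.
rewrite mcoeffZ killX; case: ifPn => // m'A; rewrite mcoeff0 mcoeffX.
by case: eqP mA m'A => [->|]; [move/negbTE->|].
Qed.

Lemma var_primeP A f : var_prime A f <-> kill A f = 0.
Proof.
split=> [fA|fA m mf].
  apply/mpolyP => m; rewrite mcoeff_kill mcoeff0.
  by case: ifPn => // mA; apply: memN_msupp_eq0; apply: contra mA; apply: fA.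
apply: contraT => mA; rewrite mcoeff_msupp in mf.
have := congr1 (mcoeff m) fA.
by rewrite mcoeff_kill (negbTE mA) mcoeff0 => /eqP; rewrite (negbTE mf).
Qed.

Lemma kill_sub A f : var_prime A (f - kill A f).
Proof.
move=> m; rewrite mcoeff_msupp mcoeffB mcoeff_kill.
by case: ifP => // _; rewrite subrr eqxx.
Qed.

Lemma kill_msupp A f m : m \in msupp (kill A f) -> ~~ involves A m.
Proof. by rewrite mcoeff_msupp mcoeff_kill; case: ifP => //; rewrite eqxx. Qed.

Lemma var_prime_prime A : is_prime (var_prime A).
Proof.
split; first exact: var_prime_ideal.
  rewrite -mpolyX0 => /span_monX/involvesP[k _].
  by rewrite mnm0E.
move=> f g /var_primeP; rewrite killM => /eqP.
by rewrite mulf_eq0 => /orP[] /eqP fg; [left|right]; apply/var_primeP.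
Qed.

Lemma prime_mon P m : is_prime P -> P 'X_[m] -> exists2 k, (0 < m k)%N & P 'X_k.
Proof.
move=> Pp; rewrite mpolyXE_id => /(prime_prod Pp)[k].
have [->|mk] := posnP (m k); last by move/(prime_X Pp); exists k.
by rewrite expr0; case: Pp.
Qed.

Lemma primary_radical_prime Q P : is_primary Q P -> is_prime P.
Proof.
case=> Qid Q1 QM <-; split; first exact: radical_ideal.
  by case=> k; rewrite expr1n.
move=> f g [k]; rewrite exprMn => /QM[]; first by left; exists k.
by case=> l; rewrite -exprM; right; exists (k * l)%N.
Qed.

(** The leading monomial of a member of [P] has a power in [Q]. Applied to the
    part of [f] made of the monomials free of the variables in [P], this shows
    that the part is zero. *)
Lemma monomial_primary_var_prime Q P : is_monomial_ideal Q -> is_primary Q P ->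
  exists A, P = var_prime A.
Proof.
move=> Qmon Qprim; have Pp := primary_radical_prime Qprim.
have Pid := prime_ideal Pp; have [Qid Q1 _ QP] := Qprim.
pose A := [set k | `[< P 'X_k >]]%SET.
have AP : var_prime A `<=` P.
  by apply: var_prime_sub => // k; rewrite inE => /asboolP.
exists A; apply/seteqP; split=> // f Pf; apply/var_primeP.
apply/eqP/contraT => f0.
have : P (kill A f).
  by rewrite -[kill A f](subKr f); apply: idealB => //; apply/AP/kill_sub.
rewrite -QP => -[l Qfl].
have Ql : Q 'X_[mlead (kill A f) *+ l].
  apply: monomial_ideal_msupp Qmon Qfl _.
  by rewrite -mleadX // mlead_supp // expf_neq0.
have [k mk Pk] : exists2 k, (0 < mlead (kill A f) k)%N & P 'X_k.
  by apply: prime_mon => //; rewrite -QP; exists l; rewrite /= mpolyXn.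
have /negP[] := kill_msupp (mlead_supp f0).
by apply/involvesP; exists k => //; rewrite inE; apply/asboolP.
Qed.

End Monomial.

(** * Existence and uniqueness of decompositions *)

Section Decomposition.
Variables (K : fieldType) (n : nat).
Local Notation S := {mpoly K[n]}.
Implicit Types (U : set 'X_{1..n}) (I J : set S) (A : {set 'I_n}) (f g : S).

(** For one variable after the other, multiply by the last power that stays
    outside [J]. *)
Lemma colon_socle J (r : seq 'I_n) f : is_ideal J ->
  ~ J f -> (forall k, k \in r -> radical J 'X_k) ->
  exists g, ~ J (g * f) /\ forall k, k \in r -> J ('X_k * (g * f)).
Proof.
move=> Jid nJf; elim: r => [_|k r IHr rad].
  by exists 1; rewrite mul1r; split.
have [|g [nJg gr]] := IHr; first by move=> j jr; apply: rad; rewrite in_cons jr orbT.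
have exE : exists e, `[< J ('X_k ^+ e * (g * f)) >].
  have [e Je] := rad k (mem_head _ _).
  by exists e; apply/asboolP; apply: ideal_mull.
case: (ex_minnP exE) => -[|e] /asboolP Je mine.
  by rewrite mul1r in Je.
exists ('X_k ^+ e * g); rewrite -mulrA; split.
  by move=> /asboolP/mine; rewrite ltnn.
move=> j; rewrite in_cons => /predU1P[->|/gr Jj].
  by rewrite mulrA -exprS.
by rewrite mulrCA; apply: ideal_mulr.
Qed.

(** An element of the other components outside [Q i], multiplied by a monomial
    that brings it into the socle of [Q i], has annihilator [P i]. *)
Lemma Ass_decomposition I s (Q P : 'I_s -> set S) :
  irredundant_primary_decomposition I Q P -> Ass I = range P.
Proof.
case=> QP _ IQ irr; have Qprim i : is_primary (Q i) (P i) by have [] := QP i.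
apply/seteqP; split; first by rewrite IQ; apply: Ass_sub_decomposition.
move=> _ [i _ <-]; split; first exact: primary_radical_prime (Qprim i).
have [f fcap nIf] : exists2 f, ideal_cap (predC1 i) Q f & ~ I f.
  apply: contrapT => nof; apply: (irr i); rewrite IQ; apply/seteqP; split=> f fQ.
    by move=> j _; apply: fQ.
  by apply: contrapT => nIf; apply: nof; exists f; rewrite // IQ.
have Qid j := primary_ideal (Qprim j).
have nQf : ~ Q i f.
  move=> Qf; apply: nIf; rewrite IQ => j _.
  by have [->//|ji] := eqVneq j i; apply: fcap; rewrite inE.
have [Qmon _] := QP i; have [A PA] := monomial_primary_var_prime Qmon (Qprim i).
have Irad k : k \in enum A -> radical (Q i) 'X_k.
  by rewrite mem_enum; case: (Qprim i) => _ _ _ ->; rewrite PA => /var_primeX.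
have [g [nQg gA]] := colon_socle (Qid i) nQf Irad.
exists (g * f); rewrite {1}PA; apply/seteqP; split=> h.
  apply: var_prime_sub => [|k kA].
    split=> [|h1 h2 I1 I2|b h1 I1] /=; rewrite ?mul0r ?mulrDl -?mulrA.
    - by rewrite IQ => j _; apply: ideal0.
    - by move: I1 I2; rewrite IQ => I1 I2 j _; apply: ideal_add => //; [exact: I1|exact: I2].
    - by move: I1; rewrite IQ => I1 j _; apply: ideal_mulr => //; exact: I1.
  rewrite /= IQ => j _; have [->|ji] := eqVneq j i; first by apply: gA; rewrite mem_enum.
  by rewrite mulrA; apply: ideal_mulr => //; apply: fcap; rewrite inE.
rewrite /= {1}IQ => /(_ i isT); rewrite mulrC -PA => Qgh.
by apply: contrapT => nPh; apply: nQg; apply: (primary_cancel (Qprim i)) Qgh nPh.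
Qed.

(** Jump repeatedly to an index where the minimum of the remaining terms is
    attained. *)
Lemma nondecreasing_subseq (u : nat -> nat) :
  exists phi : nat -> nat, {homo phi : i j / (i < j)%N} /\
    forall i j, (i <= j)%N -> (u (phi i) <= u (phi j))%N.
Proof.
have /choice[g gP] i : exists j, (i <= j)%N /\ forall l, (i <= l)%N -> (u j <= u l)%N.
  have exv : exists v, `[< exists2 j, (i <= j)%N & u j = v >].
    by exists (u i); apply/asboolP; exists i.
  case: (ex_minnP exv) => v /asboolP[j ij uj] minv; exists j; split=> // l il.
  by rewrite uj; apply: minv; apply/asboolP; exists l.
pose phi := fix phi i := if i is i'.+1 then g (phi i').+1 else g 0%N.
have phiS i : (phi i < phi i.+1)%N by have [] := gP (phi i).+1.
have phi_lt : {homo phi : i j / (i < j)%N}.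
  move=> i j; elim: j => // j IHj; rewrite ltnS leq_eqVlt => /predU1P[->//|ij].
  exact: ltn_trans (IHj ij) (phiS j).
have phi_min i l : (phi i <= l)%N -> (u (phi i) <= u l)%N.
  case: i => [|i] /= il.
    by have [_] := gP 0%N; apply.
  have [gi gmin] := gP (phi i).+1.
  by apply: gmin; apply: leq_trans il.
exists phi; split=> // i j ij; apply: phi_min.
by move: ij; rewrite leq_eqVlt => /predU1P[->//|/phi_lt/ltnW].
Qed.

Lemma nondecreasing_subseq_vec (w : nat -> 'I_n -> nat) (r : seq 'I_n) :
  exists phi : nat -> nat, {homo phi : i j / (i < j)%N} /\
    forall k, k \in r -> forall i j, (i <= j)%N -> (w (phi i) k <= w (phi j) k)%N.
Proof.
elim: r => [|k r [phi [phi_lt phir]]]; first by exists id; split.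
have [psi [psi_lt psik]] := nondecreasing_subseq (fun i => w (phi i) k).
exists (phi \o psi); split=> [i j ij|l]; first exact/phi_lt/psi_lt.
rewrite in_cons => /predU1P[->//|lr] i j ij; apply: phir => //.
by move: ij; rewrite leq_eqVlt => /predU1P[->//|/psi_lt/ltnW].
Qed.

Lemma up_closed_le U (m m' : 'X_{1..n}) :
  up_closed U -> (forall k, m k <= m' k)%N -> U m -> U m'.
Proof.
by move=> Uup /mnm_lepP mm' Um; rewrite -(mnm_subK mm'); apply: Uup.
Qed.

(** A form of Dickson's lemma. If it failed for every [N], the counterexamples
    would have a subsequence nondecreasing in each coordinate, and the
    truncation of a late term would dominate the first term. *)
Lemma dickson_truncation U : up_closed U ->
  exists N, forall m, U m -> U [multinom minn (m k) N | k < n].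
Proof.
move=> Uup; apply: contrapT => noN.
have /choice[w wP] N : exists m : 'X_{1..n}, U m /\ ~ U [multinom minn (m k) N | k < n].
  apply: contrapT => now; apply: noN; exists N => m Um.
  by apply: contrapT => nU; apply: now; exists m.
have [phi [phi_lt phi_mono]] := nondecreasing_subseq_vec (fun i k => w i k) (enum 'I_n).
have phi_ge i : (i <= phi i)%N.
  by elim: i => // i IHi; apply: leq_ltn_trans IHi (phi_lt _ _ _).
pose b := mdeg (w (phi 0%N)).
have [_ []] := wP (phi b); have [U0 _] := wP (phi 0%N).
apply: up_closed_le U0 => // k; rewrite mnmE leq_min phi_mono ?mem_enum //=.
apply: leq_trans (phi_ge b).
by rewrite /b mdegE (bigD1 k) //= leq_addr.
Qed.

(** The monomials of [I_A + (x_k ^ N, k \in A)], where [I_A] is the contraction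
    to the polynomial ring of the localization at [var_prime A] of the ideal
    spanned by [U]. *)
Definition component U N A : set 'X_{1..n} :=
  [set m : 'X_{1..n} | (exists2 k, k \in A & (N <= m k)%N) \/
           exists2 l, ~~ involves A l & U (m + l)%MM].

Lemma component_up U N A : up_closed U -> up_closed (component U N A).
Proof.
move=> Uup m m' [[k kA Nk]|[l lA Ul]]; [left|right].
  by exists k => //; rewrite mnmDE; apply: leq_trans (leq_addr _ _).
exists l => //; suff -> : (m + m' + l = m + l + m')%MM by apply: Uup.
by rewrite -!addmA [(m' + l)%MM]addmC.
Qed.

Lemma involvesD A (m m' : 'X_{1..n}) : involves A (m + m')%MM = involves A m || involves A m'.
Proof.
apply/involvesP/orP => [[k kA]|[] /involvesP[k kA mk]].
- by rewrite mnmDE addn_gt0 => /orP[]; [left|right]; apply/involvesP; exists k.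
- by exists k => //; rewrite mnmDE addn_gt0 mk.
- by exists k => //; rewrite mnmDE addn_gt0 mk orbT.
Qed.

Lemma component_cancel U N A (m m' : 'X_{1..n}) :
  ~~ involves A m' -> component U N A (m + m')%MM -> component U N A m.
Proof.
move=> m'A [[k kA Nk]|[l lA Ul]]; [left|right].
  exists k => //; move: Nk; rewrite mnmDE.
  have [->|m'k] := posnP (m' k); first by rewrite addn0.
  by case/involvesP: m'A; exists k.
by exists (m' + l)%MM; rewrite ?involvesD ?negb_or ?m'A // addmA.
Qed.

(** Split [g] as [u + v] with [v] in [var_prime A] and [u] free of the variables
    of [A]. If [f * g] lies in the ideal, then so does [f * u ^+ l] for large
    [l], [v] being nilpotent modulo it; comparing leading monomials, [u ^+ l]
    can be cancelled unless it is zero. *)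
Lemma component_primary U N A : up_closed U -> ~ component U N A 0%MM ->
  is_primary (span_mon (component U N A) : set S) (var_prime A).
Proof.
move=> Uup nV0; set V := component U N A.
have Vup : up_closed V := component_up Uup.
set Q := span_mon V : set S; have Qid : is_ideal Q by apply: span_mon_ideal.
have pQ : var_prime A `<=` radical Q.
  apply: var_prime_sub => [|k kA]; first exact: radical_ideal.
  exists N; rewrite /= mpolyXn; apply/span_monX; left; exists k => //.
  by rewrite mulmnE mnm1E eqxx mul1n.
have Qp : Q `<=` var_prime A.
  move=> f Qf m mf; apply: contraT => mA; case: nV0.
  by apply: (component_cancel mA); rewrite add0m; apply: Qf.
have radQ : radical Q = var_prime A.
  apply/seteqP; split=> // f /(radicalS Qp); apply: prime_radical.
  exact: var_prime_prime.
split=> //; first by rewrite -mpolyX0 => /span_monX.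
move=> f g Qfg; rewrite radQ.
have [ug|ug] := eqVneq (kill A g) 0; [by right; apply/var_primeP|left].
have [l Ql] : radical Q (g - kill A g) by apply/pQ/kill_sub.
have Qful : Q (f * kill A g ^+ l).
  have -> : f * kill A g ^+ l
      = f * ((kill A g ^+ l - (- (g - kill A g)) ^+ l)) + f * (- (g - kill A g)) ^+ l.
    by rewrite mulrBr subrK.
  apply: (ideal_add Qid); last by rewrite exprNn mulrA; apply: (ideal_mulr _ Qid).
  by rewrite subrXX opprK [_ + (_ - _)]addrC subrK mulrA; apply: (ideal_mull _ Qid).
have {Qful ug} [u u0 [uA Qfu]] : exists2 u : S, u != 0 &
    (forall m, m \in msupp u -> ~~ involves A m) /\ Q (f * u).
  exists (kill A g ^+ l); first by rewrite expf_neq0.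
  split=> // m; have -> : kill A g ^+ l = kill A (g ^+ l) by rewrite /kill rmorphXn.
  exact: kill_msupp.
pose f1 := \sum_(m <- msupp f | `[< V m >]) f@_m *: 'X_[m] : S.
have Qf1 : Q f1.
  rewrite /f1; apply: (ideal_bigsum _ Qid) => m /asboolP Vm; rewrite -mul_mpolyC.
  by apply: (ideal_mulr _ Qid); apply/span_monX.
have [/eqP|f10] := eqVneq (f - f1) 0; first by rewrite subr_eq0 => /eqP ->.
have : Q ((f - f1) * u) by rewrite mulrBl; apply: (idealB Qid) => //; apply: (ideal_mull _ Qid).
have mlf : mlead ((f - f1) * u) \in msupp ((f - f1) * u) by rewrite mlead_supp ?mulf_neq0.
move/(_ _ mlf); rewrite mleadM // => /(component_cancel (uA _ (mlead_supp u0))) Vf.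
move: Vf (mlead_supp f10); set m0 := mlead _ => Vm0; rewrite mcoeff_msupp.
have -> : f - f1 = \sum_(m <- msupp f | ~~ `[< V m >]) f@_m *: 'X_[m].
  by rewrite {1}(mpolyE f) (bigID (fun m => `[< V m >])) /= addrC addrK.
rewrite raddf_sum /= big1 ?eqxx // => m /asboolP nVm; rewrite mcoeffZ mcoeffX.
by case: eqP nVm => [->|]; rewrite ?mulr0.
Qed.

(** A monomial [m] lying in every component lies in the one for the set of
    variables where its exponents are below [N]; the truncation at [N] of the
    member of [U] that this provides divides [m]. *)
Lemma component_cap U N : up_closed U ->
  (forall m, U m -> U [multinom minn (m k) N | k < n]) ->
  span_mon U = ideal_cap predT (fun A => span_mon (component U N A) : set S).
Proof.
move=> Uup Utrunc; apply/seteqP; split=> f Uf.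
  move=> A _ m /Uf Um; right; exists 0%MM; last by rewrite addm0.
  by apply/involvesP => -[k _]; rewrite mnm0E.
move=> m mf; pose A := [set k | (m k < N)%N]%SET.
have [[k]|[l lA Uml]] := Uf A isT m mf; first by rewrite inE ltnNge => /negbTE ->.
apply: up_closed_le (Utrunc _ Uml) => // k; rewrite mnmE mnmDE.
have [kA|kA] := boolP (k \in A); last by apply: leq_trans (geq_minr _ _) _; rewrite inE -leqNgt in kA.
have [->|lk] := posnP (l k); first by rewrite addn0 geq_minl.
by case/involvesP: lA; exists k.
Qed.

(** Take a subfamily of least cardinality with the same intersection. *)
Lemma irredundant_subfamily (R : comNzRingType) (T : finType) (Q : T -> set R)
    (F0 : {set T}) : exists F : {set T}, [/\ F \subset F0,
      ideal_cap (mem F) Q = ideal_cap (mem F0) Q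
    & forall x, x \in F -> ideal_cap (mem F) Q <> ideal_cap (mem (F :\ x)%SET) Q].
Proof.
pose ok (F : {set T}) := (F \subset F0) && `[< ideal_cap (mem F) Q = ideal_cap (mem F0) Q >].
have ok0 : ok F0 by rewrite /ok subxx; apply/asboolP.
case: (arg_minnP (fun F : {set T} => #|F|) ok0) => F /andP[FF0 /asboolP capF] minF.
exists F; split=> // x xF capFx; have := minF (F :\ x)%SET.
rewrite /ok (fintype.subset_trans (subsetDl _ _) FF0) -capFx capF.
rewrite (cardsD1 x F) xF ltnn => H.
by have := H (introT (asboolP _) erefl).
Qed.

Lemma monomial_decomposition_exists I : is_monomial_ideal I ->
  exists s (Q P : 'I_s -> set S), irredundant_primary_decomposition I Q P.
Proof.
move=> Imon; rewrite (monomial_ideal_span Imon); set U := [set m | _].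
have Uup : up_closed U := mon_up_closed (monomial_ideal_ideal Imon).
have [N Utrunc] := dickson_truncation Uup.
pose Q A : set S := span_mon (component U N A).
pose F0 := [set A | `[< ~ component U N A 0%MM >]]%SET.
have [F [FF0 capF irrF]] := irredundant_subfamily Q F0.
have UF : span_mon U = ideal_cap (mem F) Q.
  rewrite (component_cap Uup Utrunc) capF; apply/seteqP; split=> f Qf A _.
    exact: Qf.
  have [V0|nV0] := pselect (component U N A 0%MM).
    by move=> m _; rewrite -[m]add0m; apply: component_up.
  by apply: Qf; rewrite inE; apply/asboolP.
exists #|F|, (fun i => Q (enum_val i)), (fun i => var_prime (enum_val i)); split.
- move=> i; split; first exact/span_mon_monomial/component_up.
  apply: component_primary => //; apply/asboolP.
  by have := fintype.subsetP FF0 _ (enum_valP i); rewrite inE.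
- by move=> i j /var_prime_inj/enum_val_inj.
- rewrite UF; apply/seteqP; split=> f Qf; first by move=> i _; apply/Qf/enum_valP.
  by move=> A AF; rewrite -(enum_rankK_in AF AF); apply: Qf.
- move=> i UFi; apply: (irrF _ (enum_valP i)); rewrite -UF UFi.
  apply/seteqP; split=> f Qf.
    move=> A; rewrite !inE => /andP[Ai AF].
    rewrite -(enum_rankK_in AF AF); apply: Qf; apply: contraNneq Ai => <-.
    by rewrite enum_rankK_in.
  move=> j ji; apply: Qf; rewrite !inE enum_valP andbT.
  by apply: contraNneq ji => /enum_val_inj ->.
Qed.

End Decomposition.

(** * The height of a prime generated by variables *)

Section Relations.
Variables (K : fieldType) (n : nat).
Local Notation S := {mpoly K[n]}.
Implicit Types (P : set S) (B : {set 'I_n}) (ys : seq S).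

(** The value at [ys] of the polynomial with exponents below [N] and
    coefficients [v], as an iterated sum in Horner order. *)
Fixpoint rel_value N ys (v : seq nat -> K) : S :=
  if ys is y :: ys' then
    \sum_(j < N) y ^+ j * rel_value N ys' (fun e => v ((j : nat) :: e))
  else (v [::])%:MP.

Lemma rel_value_sum N ys (T : finType) (a : T -> K) (u : T -> seq nat -> K) :
  rel_value N ys (fun e => \sum_x a x * u x e) = \sum_x a x *: rel_value N ys (u x).
Proof.
elim: ys u => /= [|y ys IHys] u.
  by rewrite raddf_sum; apply: eq_bigr => x _; rewrite -mul_mpolyC -mpolyCM.
under eq_bigr => j _ do rewrite IHys big_distrr.
rewrite exchange_big; apply: eq_bigr => x _; rewrite scaler_sumr.
by apply: eq_bigr => j _; rewrite scalerAr.
Qed.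

Lemma rel_value_eq0 N ys v :
  (forall e, size e = size ys -> all (ltn^~ N) e -> v e = 0) -> rel_value N ys v = 0.
Proof.
elim: ys v => /= [|y ys IHys] v v0; first by rewrite v0 ?mpolyC0.
rewrite big1 // => j _; rewrite IHys ?mulr0 // => e se eN.
by apply: v0; rewrite /= ?se // ltn_ord.
Qed.

(** The sum lies in [P'] and is [g 0] plus a multiple of [y], so [g 0] lies in
    [P'], hence vanishes, and the remaining sum can be divided by [y] modulo
    [P]. *)
Lemma prime_relation P P' (y : S) N (g : nat -> S) :
  is_prime P -> is_ideal P' -> P `<=` P' -> P' y -> ~ P y ->
  (forall j, (j < N)%N -> P' (g j) -> g j = 0) ->
  P (\sum_(j < N) y ^+ j * g j) -> forall j, (j < N)%N -> g j = 0.
Proof.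
move=> Pp P'id PP' P'y nPy; elim: N g => // N IHN g gP'.
rewrite big_ord_recl expr0 mul1r.
under eq_bigr do rewrite exprS -mulrA; rewrite -big_distrr /= => Pg.
have g0 : g 0%N = 0.
  apply: gP' => //; rewrite -[g 0%N](addrK (y * \sum_(i < N) y ^+ i * g i.+1)).
  by apply: idealB => //; [apply: PP'|apply: ideal_mull].
have [_ _ PM] := Pp; move: Pg; rewrite g0 add0r => /PM[//|Pg].
case=> // j jN; apply: (IHN (fun j => g j.+1)) => // i iN; exact: gP'.
Qed.

(** Along a strict chain of primes, the lexicographically least term of a
    relation between elements [c i.+1 \ c i] cannot be cancelled. *)
Lemma chain_relation N ys (c : nat -> set S) v :
  (forall i, (i <= size ys)%N -> is_prime (c i)) ->
  (forall i, (i < size ys)%N -> [/\ c i `<=` c i.+1, c i.+1 ys`_i & ~ c i ys`_i]) ->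
  c 0%N (rel_value N ys v) ->
  forall e, size e = size ys -> all (ltn^~ N) e -> v e = 0.
Proof.
elim: ys c v => /= [|y ys IHys] c v cp cy.
  move=> cv [|//] _ _; apply/eqP/contraT => v0.
  have [c0id c01 _] := cp 0%N isT; case: c01.
  by rewrite -mpolyC1 -(mulVf v0) mpolyCM; apply: ideal_mulr.
move=> cv [//|j e] /= [se] /andP[jN eN].
have [c01 c1y nc0y] := cy 0%N isT.
have IH j' : c 1%N (rel_value N ys (fun e => v (j' :: e))) ->
    forall e, size e = size ys -> all (ltn^~ N) e -> v (j' :: e) = 0.
  by apply: (IHys (fun i => c i.+1)) => i; [exact: (cp i.+1)|exact: (cy i.+1)].
apply: (IH j) => //.
pose g j := rel_value N ys (fun e => v (j :: e)).
suff -> : rel_value N ys (fun e => v (j :: e)) = 0 by apply: ideal0; apply: prime_ideal; apply: cp.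
apply: (prime_relation (g := g) (cp 0%N isT) (prime_ideal (cp 1%N isT)) c01 c1y nc0y _ cv) => //.
by move=> i iN /IH v0; apply: rel_value_eq0.
Qed.

Lemma msizeM_pred (p q : S) : (msize (p * q) <= (msize p + msize q).-1)%N.
Proof.
have [->|p0] := eqVneq p 0; first by rewrite mul0r msize0.
have [->|q0] := eqVneq q 0; first by rewrite mulr0 msize0.
by rewrite msizeM.
Qed.

Lemma msize_expr_le (y : S) D j : (msize y <= D)%N -> (msize (y ^+ j) <= (j * D).+1)%N.
Proof.
move=> yD; elim: j => [|j IHj]; first by rewrite expr0 msize1.
rewrite exprS; apply: leq_trans (msizeM_pred _ _) _.
by rewrite mulSn; lia.
Qed.

Lemma msize_rel_value N D ys v : all (fun y => msize y <= D)%N ys ->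
  (msize (rel_value N ys v) <= (size ys * (N * D)).+1)%N.
Proof.
elim: ys v => /= [|y ys IHys] v; first by rewrite msizeC leq_b1.
case/andP=> yD ysD; elim/big_ind: _ => [|p q pE qE|j _]; first by rewrite msize0.
  by apply: leq_trans (msizeD_le _ _) _; rewrite geq_max pE.
apply: leq_trans (msizeM_pred _ _) _.
have := msize_expr_le j yD; have := IHys (fun e => v ((j : nat) :: e)) ysD.
have : (j * D <= N * D)%N by rewrite leq_mul2r (ltnW (ltn_ord j)) orbT.
by rewrite mulSn; lia.
Qed.

(** There are more polynomials, of degree at most [E], than exponent vectors
    bounded by [E]. *)
Lemma mpoly_dependent (T : finType) (g : T -> S) E :
  (forall x, msize (g x) <= E.+1)%N -> (E.+1 ^ n < #|T|)%N ->
  exists2 a : T -> K, (exists x, a x != 0) & \sum_x a x *: g x = 0.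
Proof.
move=> gE cardT; pose F := {ffun 'I_n -> 'I_E.+1}.
have cardF : #|F| = (E.+1 ^ n)%N by rewrite card_ffun !card_ord.
pose M := \matrix_(i < #|T|, j < #|F|) (g (enum_val i))@_[multinom (enum_val j k : nat) | k < n].
have /rowV0Pn[v vM v0] : kermx M != 0.
  rewrite kermx_eq0 /row_free neq_ltn (leq_ltn_trans (rank_leq_col M)) //.
  by rewrite cardF.
exists (fun x => v 0 (enum_rank x)).
  have [i vi] : exists i, v 0 i != 0.
    apply/existsP; apply: contraNT v0 => /existsPn v0.
    by apply/eqP/rowP => i; rewrite mxE; apply/eqP; have := v0 i; rewrite negbK.
  by exists (enum_val i); rewrite enum_valK.
apply/mpolyP => m; rewrite mcoeff0 raddf_sum /=.
have [mE|Em] := leqP (mdeg m) E; last first.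
  by rewrite big1 // => x _; rewrite mcoeffZ memN_msupp_eq0 ?mulr0 //
    msize_mdeg_ge // (leq_trans (gE x)).
have mk k : (m k < E.+1)%N.
  by rewrite ltnS; apply: leq_trans mE; rewrite mdegE (bigD1 k) //= leq_addr.
pose f : F := [ffun k => Ordinal (mk k)].
move: vM => /sub_kermxP/matrixP/(_ 0 (enum_rank f)); rewrite !mxE => vMf.
rewrite -[RHS]vMf [RHS](reindex (@enum_rank T)) /=; last exact/onW_bij/enum_rank_bij.
apply: eq_bigr => x _; rewrite mcoeffZ mxE !enum_rankK; congr (_ * _@__).
by apply/mnmP => k; rewrite mnmE ffunE.
Qed.

(** The [N ^ n.+1] monomials with exponents below [N] in [n.+1] given elements
    have degrees linear in [N], so they live in a space of dimension
    O(N ^ n), and are linearly dependent for large [N]. *)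
Lemma krull_dim_le (c : nat -> set S) k :
  (forall i, (i <= k)%N -> is_prime (c i)) ->
  (forall i, (i < k)%N -> c i `<` c i.+1) -> (k <= n)%N.
Proof.
move=> cp clt; rewrite leqNgt; apply/negP => nk.
have /choice[y yP] i : exists y, (i < k)%N -> c i.+1 y /\ ~ c i y.
  have [ik|ki] := ltnP i k; last by exists 0.
  have [_ /existsNP[y /not_implyP[cy ncy]]] := clt i ik.
  by exists y.
pose ys := mkseq y n.+1; pose D := \max_(z <- ys) msize z.
have ysD : all (fun z => msize z <= D)%N ys.
  by apply/allP => z zys; apply: leq_bigmax_seq.
pose C := (n.+1 * D).+1; pose N := (C ^ n).+1; pose E := (n.+1 * (N * D))%N.
pose u (t : n.+1.-tuple 'I_N) (e : seq nat) : K := (e == map val t)%:R.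
have cardT : (E.+1 ^ n < #|{: n.+1.-tuple 'I_N}|)%N.
  rewrite card_tuple card_ord.
  have EC : (E.+1 <= C * N)%N.
    by rewrite /E /C mulSn addnC mulnCA mulnA [(_ * N)%N]mulnC; lia.
  apply: (@leq_ltn_trans ((C * N) ^ n)).
    by have [->|n0] := posnP n; rewrite ?expn0 ?leq_exp2r.
  by rewrite expnMn expnS ltn_pmul2r ?expn_gt0.
have [|a [t at0] aE] := mpoly_dependent (g := fun t : n.+1.-tuple 'I_N => rel_value N ys (u t)) _ cardT.
  by move=> x; have := msize_rel_value N (u x) ysD; rewrite size_mkseq.
case/eqP: at0; pose v e := \sum_t a t * u t e.
have <- : v (map val t) = a t.
  rewrite /v (bigD1 t) //= /u eqxx mulr1 big1 ?addr0 // => t' t't.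
  case: eqP => [/(inj_map val_inj)/val_inj t'E|_]; last by rewrite mulr0.
  by rewrite t'E eqxx in t't.
apply: (chain_relation (N := N) (ys := ys) (c := c)).
- by move=> i; rewrite size_mkseq => il; apply: cp; apply: leq_trans nk.
- move=> i; rewrite size_mkseq => il; rewrite nth_mkseq //.
  have ik : (i < k)%N by apply: leq_trans nk.
  by have [cy ncy] := yP i ik; have [] := clt i ik.
- by rewrite rel_value_sum aE; apply: ideal0; apply: prime_ideal; apply: cp.
- by rewrite size_map size_tuple size_mkseq.
- by apply/allP => _ /mapP[j _ ->]; apply: ltn_ord.
Qed.

(** Adjoining the variables outside [B] one by one prolongs a chain ending at
    [var_prime B] by [n - #|B|] steps, so the bound on the length of all chains
    applies. *)
Lemma height_var_prime_le B k (c : nat -> set S) :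
  prime_chain (var_prime B) k c -> (k <= #|B|)%N.
Proof.
move: {2}(#|~: B|) (erefl #|~: B|) => l; elim: l B k c => [|l IHl] B k c Bl ch.
  have -> : #|B| = n by have := cardsC B; rewrite Bl addn0 card_ord.
  by have [cp clt _] := ch; apply: krull_dim_le cp clt.
have /card_gt0P[j jB] : (0 < #|~: B|)%N by rewrite Bl.
have jnB : j \notin B by rewrite inE in jB.
have BjB : var_prime B `<` (var_prime (j |: B)%SET : set S).
  split; first exact/var_prime_le/subsetU1.
  by move=> /(_ 'X_j); rewrite !var_primeX setU11 => /(_ isT); apply/negP.
have := IHl (j |: B)%SET k.+1 _ _ (prime_chain_extend (var_prime_prime _ _) BjB ch).
rewrite cardsU1 jnB; apply.
by have := cardsC (j |: B)%SET; have := cardsC B; rewrite cardsU1 jnB Bl; lia.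
Qed.

Lemma var_prime_chain B : exists c : nat -> set S, prime_chain (var_prime B) #|B| c.
Proof.
move: {2}(#|B|) (erefl #|B|) => l; elim: l B => [|l IHl] B Bl.
  by exists (fun=> var_prime B); rewrite Bl; split=> // i _; apply: var_prime_prime.
have /card_gt0P[j jB] : (0 < #|B|)%N by rewrite Bl.
have Bj : #|(B :\ j)%SET| = l by move: Bl; rewrite (cardsD1 j) jB => -[].
have [c] := IHl _ Bj; rewrite Bj => ch.
have BjB : var_prime (B :\ j)%SET `<` (var_prime B : set S).
  split; first exact/var_prime_le/subD1set.
  by move=> /(_ 'X_j); rewrite !var_primeX setD11 => /(_ jB).
rewrite Bl; eexists; exact: prime_chain_extend (var_prime_prime _ _) BjB ch.
Qed.

Lemma height_var_prime (J : set S) B : J `<=` var_prime B ->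
  (forall P, is_prime P -> J `<=` P -> var_prime B `<=` P) -> is_height J #|B|.
Proof.
move=> JB Bmin; split.
  exists (var_prime B); split=> //; first exact: var_prime_prime.
  by split; [exact: var_prime_chain|exact: height_var_prime_le].
move=> P k Pp JP [_ Pk]; have BP := Bmin P Pp JP.
have [c ch] := var_prime_chain B.
have [PB|nPB] := pselect (P `<=` var_prime B).
  by apply: (Pk _ c); have -> : P = var_prime B by apply/seteqP.
by apply: ltnW; apply: Pk (prime_chain_extend Pp _ ch).
Qed.

End Relations.

(** * Regular sequences of variables *)

Section RegularVariables.
Variables (K : fieldType) (n : nat).
Local Notation S := {mpoly K[n]}.
Implicit Types (I : set S) (r : seq 'I_n) (f g : S).

Let vars r : seq S := [seq 'X_v | v <- r].

Lemma seq_mul_variables I r : is_monomial_ideal I ->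
  seq_mul (vars r) I =
  span_mon [set m : 'X_{1..n} | exists2 u, u \in r & (0 < m u)%N /\ I 'X_[m - U_(u)]].
Proof.
move=> Imon; have Iid := monomial_ideal_ideal Imon.
have genid : is_ideal (seq_mul (vars r) I) by apply: idealgen_ideal.
set U := [set m | _].
have Uup : up_closed U.
  move=> m m' [u ur [mu Im]]; exists u => //; rewrite mnmDE addn_gt0 mu; split=> //.
  suff -> : (m + m' - U_(u) = m - U_(u) + m')%MM by rewrite mpolyXD; apply: ideal_mull.
  apply/mnmP => l; rewrite !mnmE; case: eqP => [<-|_]; last by rewrite !subn0.
  by rewrite addnBAC.
apply/seteqP; split.
  apply: idealgen_sub => [|_ [f /= /mapP[u ur ->] [g Ig <-]] m]; first exact: span_mon_ideal.
  move=> /msuppM_le/allpairsP[[m1 m2] /= [+ m2g ->]].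
  rewrite msuppX inE => /eqP ->; exists u => //.
  rewrite mnmDE mnm1E eqxx addmC addmK; split=> //.
  exact: monomial_ideal_msupp Imon Ig m2g.
apply: span_mon_sub => // m [u ur [mu Im]]; apply: sub_gen_smallest.
exists 'X_u; first by apply/mapP; exists u.
exists 'X_[m - U_(u)] => //; rewrite -mpolyXD mnm_subK //.
by apply/mnm_lepP => l; rewrite mnm1E; case: eqP => // <-.
Qed.

Lemma graded_maximal_sub : graded_maximal (K := K) (n := n) `<=` var_prime [set: 'I_n]%SET.
Proof.
apply: idealgen_sub => [|_ [k _ <-]]; first exact: var_prime_ideal.
by apply/var_primeX; rewrite inE.
Qed.

Lemma mdeg_gt0 (m : 'X_{1..n}) k : (0 < m k)%N -> (0 < mdeg m)%N.
Proof. by move=> mk; rewrite mdegE (bigD1 k) //= addn_gt0 mk. Qed.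

(** The members of [seq_mul fs I] have no monomial of the least degree that
    occurs in [I]. *)
Lemma seq_mul_graded_maximal_proper I (fs : seq S) :
  is_ideal I -> I <> [set 0] -> [set` fs] `<=` graded_maximal (n := n) ->
  seq_mul fs I <> I.
Proof.
move=> Iid I0 fsm.
have [g Ig g0] : exists2 g, I g & g != 0.
  apply: contrapT => nog; apply: I0; apply/seteqP; split=> [g Ig|_ ->]; last exact: ideal0.
  by apply: contrapT => /eqP g0; apply: nog; exists g.
have exd : exists d, `[< exists2 g, I g & exists2 m, m \in msupp g & mdeg m = d >].
  by exists (mdeg (mlead g)); apply/asboolP; exists g => //; exists (mlead g); rewrite ?mlead_supp.
case: (ex_minnP exd) => d /asboolP[h Ih [m mh md]] mind fsI.
have : span_mon [set m : 'X_{1..n} | d < mdeg m]%N h.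
  move: Ih; rewrite -{1}fsI; apply: idealgen_sub.
    by apply: span_mon_ideal => m1 m2 /= dm1; rewrite mdegD; apply: ltn_addr.
  move=> _ [f /fsm/graded_maximal_sub fmax [p Ip <-]] m'.
  move=> /msuppM_le/allpairsP[[m1 m2] /= [/fmax/involvesP[k _ mk] m2p ->]].
  rewrite mdegD -add1n leq_add ?(mdeg_gt0 mk) //.
  by apply: mind; apply/asboolP; exists p => //; exists m2.
by move=> /(_ _ mh) /=; rewrite md ltnn.
Qed.

(** If [x_v g] lies in [(x_u) I], then [g = x_u f] on monomials, with [x_u f] and
    [x_v f] in [I]; the colon condition then puts [g] in [(x_u) I]. Membership
    of a monomial in [(x_1, ..., x_p) I] concerns one [x_u] at a time, so the
    condition on pairs suffices for longer sequences. *)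
Lemma variables_regular I r : is_monomial_ideal I -> I <> [set 0] -> uniq r ->
  (forall u v, u \in r -> v \in r -> u != v ->
     forall f, I ('X_u * f) -> I ('X_v * f) -> I f) ->
  regular_seq I (vars r).
Proof.
move=> Imon I0 ur colon; have Iid := monomial_ideal_ideal Imon.
split; last first.
  apply: seq_mul_graded_maximal_proper => // _ /= /mapP[k _ ->].
  by apply: sub_gen_smallest; exists k.
move=> i g; rewrite size_map => ir Ig.
case: r => // v0 r' in ur colon ir *; set r := v0 :: r' in ur colon ir *.
rewrite (nth_map v0) // -map_take -/(vars _) seq_mul_variables //.
set v := nth v0 r i => Ivg m mg.
have /Ivg[u ut [mu Iu]] : (U_(v) + m)%MM \in msupp ('X_v * g).
  rewrite mulrC (perm_mem (msuppMX g U_(v))).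
  by apply/mapP; exists m; rewrite // addmC.
have uv : u != v.
  apply: contraTneq ut => ->; rewrite in_take_leq ?(ltnW ir) //.
  by rewrite index_uniq // ltnn.
have mu0 : (0 < m u)%N by move: mu; rewrite mnmDE mnm1E eq_sym (negbTE uv).
exists u => //; split=> //.
have mE : (U_(u) + (m - U_(u)))%MM = m.
  by rewrite mnm_subK //; apply/mnm_lepP => l; rewrite mnm1E; case: eqP => // <-.
apply: (colon u v) => //; first exact: mem_take ut.
- exact: mem_nth.
- by rewrite -mpolyXD mE; apply: monomial_ideal_msupp mg.
- rewrite -mpolyXD; suff -> : (U_(v) + (m - U_(u)) = U_(v) + m - U_(u))%MM by [].
  by apply/mnmP => l; rewrite !mnmE addnBA //; case: eqP => // <-.
Qed.

End RegularVariables.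

(** * Decompositions with private variables *)

Section PrivateVariables.
Variables (K : fieldType) (n s : nat).
Local Notation S := {mpoly K[n]}.
Variables (I : set S) (Q : 'I_s -> set S) (A : 'I_s -> {set 'I_n}) (k : 'I_s -> 'I_n).
Hypotheses (Imon : is_monomial_ideal I) (I0 : I <> [set 0]).
Hypotheses (Qprim : forall i, is_primary (Q i) (var_prime (A i))).
Hypotheses (IQ : I = ideal_cap predT Q).
Hypotheses (kA : forall i j, (k i \in A j) = (i == j)).

Let B := (\bigcup_i A i)%SET.
Let Qid i : is_ideal (Q i) := primary_ideal (Qprim i).

Let memB i l : l \in A i -> l \in B.
Proof. by move=> lA; apply/bigcupP; exists i. Qed.

Let radQ i : radical (Q i) = var_prime (A i).
Proof. by case: (Qprim i). Qed.

Let k_inj : injective k.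
Proof. by move=> i j kij; apply/eqP; rewrite -kA kij kA. Qed.

(** A power of [x_(k i)] lies in the sum of all components, while the components
    other than [Q i] lie in a prime generated by variables different from it:
    no component can be left out of the radical of the sum. *)
Lemma private_size_of_decomposition :
  size_of_decomposition Q (s%:Z + (n%:Z - #|B|%:Z) - 1).
Proof.
exists s, #|B|; split=> //.
- exists [set: 'I_s]%SET; rewrite cardsT card_ord; split=> //; congr radical.
  apply/seteqP; split=> f [g gQ ->]; exists g => //.
  + by move=> i _; apply: gQ; rewrite inE.
  + by apply: eq_bigl => i; rewrite !inE.
  + by move=> i _; apply: gQ.
  + by apply: eq_bigl => i; rewrite !inE.
- move=> t [J [<- Jrad]]; rewrite -[leqLHS]card_ord -cardsT; apply: subset_leq_card.
  apply/fintype.subsetP => i _.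
  have [N QN] : radical (Q i) 'X_(k i) by rewrite radQ; apply/var_primeX; rewrite kA.
  have : radical (ideal_sum predT Q) 'X_(k i) by exists N; apply: ideal_sum_ge QN.
  rewrite -Jrad => radk.
  have : var_prime (\bigcup_(j in J) A j)%SET ('X_(k i) : S).
    apply: (prime_radical (var_prime_prime _ _)); apply: radicalS radk.
    apply: ideal_sum_le => [|j jJ f Qf]; first exact: var_prime_ideal.
    apply: (var_prime_le (A := A j)); first exact: finset.bigcup_sup.
    exact: primary_sub (Qprim j) _ Qf.
  by move=> /var_primeX/bigcupP[j jJ]; rewrite kA => /eqP ->.
- apply: height_var_prime.
    apply: ideal_sum_le => [|j _ f Qf]; first exact: var_prime_ideal.
    apply: (var_prime_le (A := A j)); first exact: finset.bigcup_sup.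
    exact: primary_sub (Qprim j) _ Qf.
  move=> P Pp QP; apply: var_prime_sub => [|l]; first exact: prime_ideal.
  move=> /bigcupP[i _ lA].
  have [N QN] : radical (Q i) 'X_l by rewrite radQ; apply/var_primeX.
  by apply: (prime_X (k := N) Pp); apply: QP; apply: ideal_sum_ge QN.
Qed.

Let r := [seq k i | i <- enum 'I_s] ++ enum (~: B).

Let uniq_r : uniq r.
Proof.
rewrite cat_uniq (map_inj_uniq k_inj) !enum_uniq andbT /=; apply/hasPn => l.
rewrite mem_enum inE; apply: contra => /mapP[i _ ->].
by apply: (memB (i := i)); rewrite kA.
Qed.

Let size_r : size r = (s + #|~: B|)%N.
Proof. by rewrite size_cat size_map size_enum_ord -cardE. Qed.

Let mem_r_A u i : u \in r -> u \in A i -> u = k i.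
Proof.
rewrite mem_cat => /orP[/mapP[j _ ->]|]; first by rewrite kA => /eqP ->.
by rewrite mem_enum inE => + uA; rewrite (memB uA).
Qed.

Let k_r i : k i \in r.
Proof. by rewrite mem_cat map_f ?mem_enum. Qed.

Lemma private_regular_seq : exists fs : seq S,
  [/\ [set` fs] `<=` graded_maximal (n := n), regular_seq I fs & size fs = (s + #|~: B|)%N].
Proof.
exists [seq 'X_v | v <- r]; split; last by rewrite size_map.
  by move=> _ /= /mapP[l _ ->]; apply: sub_gen_smallest; exists l.
apply: variables_regular => // u v ur vr uv f; rewrite IQ => fu fv i _.
have [uA|uA] := boolP (u \in A i).
  have vA : v \notin A i.
    by apply: contraNN uv => vA; rewrite (mem_r_A ur uA) (mem_r_A vr vA).
  apply: (primary_cancel (Qprim i) (g := 'X_v)); first by rewrite mulrC; exact: fv.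
  by move=> /var_primeX; apply/negP.
apply: (primary_cancel (Qprim i) (g := 'X_u)); first by rewrite mulrC; exact: fu.
by move=> /var_primeX; apply/negP.
Qed.

Lemma uniform_exponent : exists2 N, (0 < N)%N & forall i l, l \in A i -> Q i ('X_l ^+ N).
Proof.
have /choice[e eP] (x : 'I_s * 'I_n) : exists N, x.2 \in A x.1 -> Q x.1 ('X_x.2 ^+ N).
  have [xA|_] := boolP (x.2 \in A x.1); last by exists 0%N.
  have [N QN] : radical (Q x.1) 'X_x.2 by rewrite radQ; apply/var_primeX.
  by exists N.
exists (\max_x e x).+1 => // i l lA.
have := eP (i, l) lA; have le_e : (e (i, l) <= (\max_x e x).+1)%N.
  by apply/leqW/leq_bigmax.
by rewrite -(subnK le_e) exprD; apply: ideal_mulr.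
Qed.

(** Each variable [l] of [B] is attributed to the private variable of one of the
    primes containing it; the others are attributed to themselves. *)
Let rep (l : 'I_n) : 'I_n := if [pick i | l \in A i] is Some i then k i else l.

Let rep_spec l : if l \in B then exists2 i, l \in A i & rep l = k i else rep l = l.
Proof.
rewrite /rep; case: pickP => [i lA|noA]; first by rewrite (memB lA); exists i.
by case: ifPn => // /bigcupP[i _]; rewrite noA.
Qed.

Let rep_r l : rep l \in r.
Proof.
have := rep_spec l; case: ifPn => [_ [i _ ->] //|lB ->].
by rewrite mem_cat mem_enum inE lB orbT.
Qed.

Let rep_id v : v \in r -> rep v = v.
Proof. by have := rep_spec v; case: ifPn => // _ [i vA ->] vr; rewrite (mem_r_A vr vA). Qed.

Let rep_B l : (rep l \in B) = (l \in B).
Proof.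
have := rep_spec l; case: ifPn => [_ [i lA ->]|lB ->]; last exact/negbTE.
by apply: (memB (i := i)); rewrite kA.
Qed.

Lemma graded_maximal_power N (f : S) : graded_maximal (n := n) f ->
  exists l a, f ^+ l = \sum_j a j * 'X_j ^+ N.
Proof.
pose J : set S := [set f | exists a, f = \sum_j a j * 'X_j ^+ N].
have Jid : is_ideal J.
  split=> [|_ _ [a ->] [b ->]|b _ [a ->]].
  - by exists (fun=> 0); rewrite big1 // => j _; rewrite mul0r.
  - exists (fun j => a j + b j); rewrite -big_split.
    by apply: eq_bigr => j _; rewrite mulrDl.
  - exists (fun j => b * a j); rewrite big_distrr.
    by apply: eq_bigr => j _; rewrite /= mulrA.
apply: (idealgen_sub (J := radical J)) => [|_ [j _ <-]]; first exact: radical_ideal.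
exists N; exists (fun l => (l == j)%:R); rewrite (bigD1 j) //= eqxx mul1r.
by rewrite big1 ?addr0 // => l /negbTE ->; rewrite mul0r.
Qed.

(** The differential of the Koszul complex of the [x_l ^ N] is the exterior
    product with [\sum_l x_l ^ N e_l], a combination of the forms [form N v],
    [v \in r]; their exterior product is therefore a cocycle. *)
Let form N (v l : 'I_n) : S := if rep l == v then if l \in B then 'X_l ^+ N else 1 else 0.

Let form_sum N (l : 'I_n) :
  'X_l ^+ N = \sum_(v <- r) (if v \in B then 1 else 'X_v ^+ N) * form N v l.
Proof.
rewrite (bigD1_seq (rep l)) //= big1 ?addr0 => [|v vl]; last first.
  by rewrite /form eq_sym (negbTE vl) mulr0.
rewrite /form eqxx rep_B; have := rep_spec l.
by case: ifPn => [_ _|lB ->]; rewrite ?mul1r ?mulr1.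
Qed.

(** The exterior product of the forms is a cocycle with values in [I], as each
    [Q i] contains the values of the factor of [k i]. Its value at [r] is the
    monomial [m0] below. A coboundary there is a combination of terms
    [x_l ^ N * e t], with [l] in [r] and [e t] in [I]; a monomial of [e t]
    involves some variable of [A i] for [l = k i], but the quotient of [m0] by
    [x_(k i) ^ N] does not; and [m0] is not divisible by [x_l] for [l] outside
    [B]. *)
Lemma private_koszul_nonacyclic N : (0 < N)%N ->
  (forall i l, l \in A i -> Q i ('X_l ^+ N)) ->
  ~ koszul_acyclic (fun l => 'X_l ^+ N) I [set 0] (s + #|~: B|).
Proof.
move=> N0 QN acyc; rewrite -size_r in acyc.
have [t st|t _|e eI] := acyc (wedge (form N) r).
- rewrite IQ => i _; apply: (wedge_in (Qid i) (k_r i)) => // l.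
  rewrite /form; case: eqP => [lk|_]; last exact: ideal0.
  have := rep_spec l; case: ifPn => [_ [j lA]|lB]; rewrite lk.
    by move=> /k_inj ij; apply: QN; rewrite ij.
  by move=> kl; rewrite -kl (memB (i := i)) ?kA in lB.
- rewrite (kd_suml (r := r) _ _ (form_sum N)) big1_seq // => v /andP[_ vr].
  by rewrite wedge_cocycle // mulr0.
move=> /(_ r erefl) /= E.
pose m0 := (\sum_(i < s) (U_(k i) *+ N))%MM.
have m0E l : m0 l = (\sum_(i < s) (k i == l) * N)%N.
  by rewrite mnm_sumE; apply: eq_bigr => i _; rewrite mulmnE mnm1E.
have m0P l : (0 < m0 l)%N -> exists i, k i = l.
  rewrite m0E => m0l; apply: contrapT => nok.
  by move: m0l; rewrite big1 // => i _; case: eqP => // kil; case: nok; exists i.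
have m0k i : m0 (k i) = N.
  rewrite m0E (bigD1 i) //= eqxx mul1n big1 ?addn0 // => j ji.
  by rewrite (inj_eq k_inj) (negbTE ji).
have top_coef : (wedge (form N) r r)@_m0 = 1.
  rewrite wedge_diag // => [|u v ur vr uv]; last first.
    by rewrite /form rep_id // eq_sym (negbTE uv).
  rewrite big_cat big_map /= [X in _ * X]big1_seq ?mulr1 => [|v /andP[_ vB]]; last first.
    rewrite mem_enum inE in vB; rewrite /form rep_id ?eqxx ?(negbTE vB) //.
    by rewrite mem_cat mem_enum inE vB orbT.
  rewrite big_enum /= (_ : \prod_(i < s) _ = 'X_[m0]) ?mcoeffX ?eqxx //.
  rewrite /m0 (big_morph _ (@mpolyXD n K) (@mpolyX0 n K)); apply: eq_bigr => i _.
  by rewrite /form rep_id // eqxx (memB (i := i)) ?kA // mpolyXn.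
suff : (kd (fun l => 'X_l ^+ N) e r)@_m0 = 0.
  move/eqP: E; rewrite subr_eq0 => /eqP <-; rewrite top_coef.
  by move/eqP; rewrite oner_eq0.
apply: (kd_in_subgroup (Z := [set f : S | f@_m0 = 0])) => [|f g f0 g0|t1 l t2 rE] /=.
- by rewrite mcoeff0.
- by rewrite mcoeffB f0 g0 subrr.
apply/eqP; rewrite mcoeff_eq0; apply/negP; rewrite mpolyXn.
move=> /msuppM_le/allpairsP[[m1 m] /= [+ me mE]]; rewrite msuppX inE => /eqP m1E.
have lm0 : m0 l = (N + m l)%N by rewrite mE m1E mnmDE mulmnE mnm1E eqxx mul1n.
have [i kil] : exists i, k i = l by apply: m0P; rewrite lm0 ltn_addr.
have ml : m l = 0%N by move: lm0; rewrite -kil m0k; lia.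
have : var_prime (A i) (e (t1 ++ t2)).
  apply: (primary_sub (Qprim i)); have := eI (t1 ++ t2); rewrite IQ; apply=> //.
  by rewrite rE !size_cat /= addnS.
move=> /(_ _ me)/involvesP[j jA mj].
have [i' ki'] : exists i', k i' = j by apply: m0P; rewrite mE mnmDE ltn_addl.
by move: jA mj; rewrite -ki' kA => /eqP ->; rewrite kil ml.
Qed.

Lemma private_depth : is_depth (graded_maximal (n := n)) I (s + #|~: B|).
Proof.
split; first exact: private_regular_seq.
move=> fs fsm fsreg; rewrite leqNgt; apply/negP => ltfs.
have [N N0 QN] := uniform_exponent.
apply: (private_koszul_nonacyclic N0 QN).
apply: (regular_seq_koszul_acyclic _ fsreg) ltfs; first exact: monomial_ideal_ideal.
by move=> f /fsm; apply: graded_maximal_power.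
Qed.

End PrivateVariables.

(** * Minimal depth *)

Theorem corollary1p3 (K : fieldType) (n : nat) (I : set {mpoly K[n]})
    (s : nat) (P : 'I_s -> set {mpoly K[n]})
    (I_monomial : is_monomial_ideal I)
    (I_nonzero : I <> [set 0])
    (I_proper : I <> setT)
    (P_distinct : injective P)
    (P_Ass : Ass I = range P)
    (P_notin_sum : forall i : 'I_s, ~ (P i `<=` ideal_sum (predC1 i) P)) :
  has_minimal_depth I.
Proof.
have reindexing s' (Q' P' : 'I_s' -> set {mpoly K[n]}) :
    irredundant_primary_decomposition I Q' P' ->
    exists sg : 'I_s' -> 'I_s, bijective sg /\ forall i, P' i = P (sg i).
  move=> dec; have AssP' := Ass_decomposition dec.
  have /choice[sg sgP] i : exists j, P' i = P j.
    have [j _ Pj] : range P (P' i) by rewrite -P_Ass AssP'; exists i.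
    by exists j.
  have /choice[tau tauP] j : exists i, P j = P' i.
    have [i _ Pi] : range P' (P j) by rewrite -AssP' P_Ass; exists j.
    by exists i.
  have [_ P'_inj _ _] := dec.
  exists sg; split=> //; exists tau => [i|j]; last by apply: P_distinct; rewrite -sgP -tauP.
  by apply: P'_inj; rewrite -tauP -sgP.
have Pvar j : exists A, P j = var_prime A.
  have [s' [Q' [P' dec]]] := monomial_decomposition_exists I_monomial.
  have [sg [[tau sgK tauK] sgP]] := reindexing _ _ _ dec.
  have [Q'P _ _ _] := dec; have [Qmon Qprim] := Q'P (tau j).
  by rewrite -(tauK j) -sgP; apply: monomial_primary_var_prime Qmon Qprim.
have [A PA] := choice Pvar.
have Pid j : is_ideal (P j) by rewrite PA; apply: var_prime_ideal.
have /choice[k kA] i : exists k, forall j, (k \in A j) = (i == j).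
  have [k kAi noA] : exists2 k, k \in A i & forall j, j != i -> k \notin A j.
    apply: contrapT => nok; apply: (P_notin_sum i); rewrite {1}PA.
    apply: var_prime_sub => [|k kAi]; first exact: ideal_sum_ideal.
    have [j ji kAj] : exists2 j, j != i & k \in A j.
      apply: contrapT => noj; apply: nok; exists k => // j ji.
      by apply/negP => kAj; apply: noj; exists j.
    by apply: (ideal_sum_ge (i := j)) => //; rewrite PA; apply/var_primeX.
  by exists k => j; case: eqVneq => [<-//|ij]; apply/negbTE/noA; rewrite eq_sym.
pose B := (\bigcup_j A j)%SET.
have invariants s' (Q' P' : 'I_s' -> set {mpoly K[n]}) :
    irredundant_primary_decomposition I Q' P' ->
    is_depth (graded_maximal (n := n)) I (s + #|~: B|) /\
    size_of_decomposition Q' (s%:Z + (n%:Z - #|B|%:Z) - 1).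
  move=> dec; have [sg [sgbij sgP]] := reindexing _ _ _ dec.
  have [Q'P _ IQ' _] := dec.
  have Qprim i : is_primary (Q' i) (var_prime (A (sg i))).
    by rewrite -PA -sgP; have [] := Q'P i.
  have kA' i j : (k (sg i) \in A (sg j)) = (i == j) by rewrite kA (bij_eq sgbij).
  have -> : B = (\bigcup_i A (sg i))%SET by rewrite /B (reindex sg) //=; apply: onW_bij.
  have -> : s = s' by have := bij_eq_card sgbij; rewrite !card_ord.
  split; first exact: private_depth Qprim IQ' kA'.
  exact: private_size_of_decomposition Qprim kA'.
have [s' [Q' [P' dec]]] := monomial_decomposition_exists I_monomial.
exists (s + #|~: B|)%N, (s%:Z + (n%:Z - #|B|%:Z) - 1); split.
- by have [] := invariants _ _ _ dec.
- split; first by exists s', Q', P'.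
  by move=> s'' Q'' P'' /invariants[].
- by have := cardsC B; rewrite card_ord; lia.
Qed.
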